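(* Let $F$ be the field of meromorphic functions on a complex domain $D\subseteq\mathbb{C}$, let $n,s\ge1$ and $\mathcal{M}=\begin{pmatrix}\mathcal{A}&\mathcal{B}\\\mathcal{C}&\mathcal{D}\end{pmatrix}\in F^{(n+s)\times(n+s)}$ with $\mathcal{A}\in F^{n\times n}$, $\mathcal{D}\in F^{s\times s}$. Let $\mathcal{X},\mathcal{Y}\in F^{n\times n}$ be regular (invertible over $F$), let $f\in F$, and let $\mathrm{a}(x)\in F[x]\setminus\{0\}$ satisfy $\mathrm{a}(f\mathbf{I}_n-\mathcal{X}\mathcal{A}\mathcal{Y})\equiv\mathbf{0}$. Set $$\mathcal{P}=\mathcal{Y}\,\mathrm{p}(f,f\mathbf{I}_n-\mathcal{X}\mathcal{A}\mathcal{Y};\mathrm{a})\,\mathcal{X},\qquad \mathcal{S}=\mathrm{a}(f)\,\mathcal{D}-\mathcal{C}\mathcal{P}\mathcal{B}\in F^{s\times s}.$$ If $(\lambda_0,\mathbf{w}_0)$ is a latent pair of $\mathcal{S}$ such that $\lambda_0$ is not a root of $\mathrm{a}(f)$, then $$\left(\lambda_0,\begin{pmatrix}-\mathcal{P}(\lambda_0)\mathcal{B}(\lambda_0)\\ \mathrm{a}(f)(\lambda_0)\,\mathbf{I}_s\end{pmatrix}\mathbf{w}_0\right)$$ is a latent pair of $\mathcal{M}$.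
   Context: For a polynomial $\mathrm{a}(x)=\sum_{k=0}^{d}a_kx^k\in F[x]$, $f\in F$ and $\mathcal{Z}\in F^{n\times n}$: $\mathrm{p}(f,\mathcal{Z};\mathrm{a})=\sum_{k=1}^{d}a_k\sum_{i=1}^{k}f^{\,i-1}\mathcal{Z}^{k-i}$. Let $P\subset D$ be the set of points that are poles of $f$, of an entry of $\mathcal{M}$, $\mathcal{X}$ or $\mathcal{Y}$, or of a coefficient of $\mathrm{a}(x)$, and let $D_P=D\setminus P$. A latent pair of a square matrix $\mathcal{Z}\in\{\mathcal{M},\mathcal{S}\}$ of size $r$ is a pair $(\lambda,\mathbf{u})$ with $\lambda\in D_P$, $\mathbf{0}\ne\mathbf{u}\in\mathbb{C}^r$ and $\mathcal{Z}(\lambda)\mathbf{u}=\mathbf{0}$. A root of $\mathrm{a}(f)$ is a point $\lambda\in D_P$ at which the function $\mathrm{a}(f)\in F$ vanishes. *)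

(* Defs.v *)
From HB Require Import structures.
From mathcomp Require Import all_boot all_order all_algebra.
From mathcomp Require Import complex.
From mathcomp Require Import all_classical all_reals all_analysis.

Set Implicit Arguments.
Unset Strict Implicit.
Unset Printing Implicit Defensive.

Import Order.TTheory GRing.Theory Num.Theory.
Import numFieldNormedType.Exports.

Local Open Scope classical_set_scope.
Local Open Scope ring_scope.

(* [R[i]^o] is the complex plane seen as a normed space over itself, so that
   [derivable g z 1] is complex differentiability at [z]. *)
Notation cplane R := (R[i]^o).

Record domain (R : realType) := Domain {
  dom_set : set (cplane R);
  dom_open : open dom_set;
  dom_connected : connected dom_set;
  dom_nonempty : dom_set !=set0 }.

Section MeromorphicAt.
Variable R : realType.
Implicit Types (f g : cplane R -> cplane R) (z : cplane R).

Definition holomorphic_at g z := \forall w \near z, derivable g w 1.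

Definition removable_at f z :=
  exists2 g, holomorphic_at g z & \forall w \near z^', f w = g w.

Definition meromorphic_at f z :=
  exists N : nat, exists2 g, holomorphic_at g z &
    \forall w \near z^', f w = g w / (w - z) ^+ N.

Lemma holomorphic_cst (c : cplane R) z : holomorphic_at (fun=> c) z.
Proof.
by rewrite /holomorphic_at; near=> w; exact: derivable_cst.
Unshelve. all: by end_near. Qed.

Lemma holomorphicB f g z :
  holomorphic_at f z -> holomorphic_at g z ->
  holomorphic_at (fun w => f w - g w) z.
Proof.
rewrite /holomorphic_at => hf hg.
apply: filterS2 hf hg => w df dg.
exact: derivableB df dg.
Qed.

Lemma holomorphicM f g z :
  holomorphic_at f z -> holomorphic_at g z ->
  holomorphic_at (fun w => f w * g w) z.
Proof.
rewrite /holomorphic_at => hf hg.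
apply: filterS2 hf hg => w df dg.
exact: derivableM df dg.
Qed.

Lemma holomorphic_subX (c : cplane R) N z :
  holomorphic_at (fun w => (w - c) ^+ N) z.
Proof.
elim: N => [|N IH]; first exact: holomorphic_cst.
under [X in holomorphic_at X]eq_fun do rewrite exprS.
apply: (holomorphicM _ IH); apply: (holomorphicB _ (holomorphic_cst c z)).
by rewrite /holomorphic_at; near=> w; exact: derivable_id.
Unshelve. all: by end_near. Qed.

Lemma meromorphic_cst (c : cplane R) z : meromorphic_at (fun=> c) z.
Proof.
exists 0%N; exists (fun=> c); first exact: holomorphic_cst.
by near=> w; rewrite expr0 divr1.
Unshelve. all: by end_near. Qed.

Lemma meromorphicB f g z :
  meromorphic_at f z -> meromorphic_at g z -> meromorphic_at (f - g) z.
Proof.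
move=> [N [f0 hf ef]] [K [g0 hg eg]].
exists (N + K)%N.
exists (fun w => f0 w * (w - z) ^+ K - g0 w * (w - z) ^+ N).
  exact: holomorphicB (holomorphicM hf (holomorphic_subX z K z))
                      (holomorphicM hg (holomorphic_subX z N z)).
near=> w.
have wz : w - z != 0 by rewrite subr_eq0; near: w; exact: nbhs_dnbhs_neq.
have -> : (f - g) w = f w - g w by [].
have -> : f w = f0 w / (w - z) ^+ N by near: w.
have -> : g w = g0 w / (w - z) ^+ K by near: w.
rewrite exprD mulrBl; congr (_ - _).
  by rewrite invfM -!mulrA; congr (_ * _); rewrite mulrCA mulfV ?mulr1// expf_neq0.
by rewrite invfM -!mulrA; congr (_ * _); rewrite mulrA mulfV ?mul1r// expf_neq0.
Unshelve. all: by end_near. Qed.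

Lemma meromorphicM f g z :
  meromorphic_at f z -> meromorphic_at g z -> meromorphic_at (f * g) z.
Proof.
move=> [N [f0 hf ef]] [K [g0 hg eg]].
exists (N + K)%N; exists (fun w => f0 w * g0 w); first exact: (holomorphicM hf hg).
near=> w.
have -> : (f * g) w = f w * g w by [].
have -> : f w = f0 w / (w - z) ^+ N by near: w.
have -> : g w = g0 w / (w - z) ^+ K by near: w.
by rewrite exprD invfM mulrACA.
Unshelve. all: by end_near. Qed.

End MeromorphicAt.

Section MeromorphicField.
Variables (R : realType) (D : domain R).

Definition meromorphic_on : {pred cplane R -> cplane R} :=
  [pred f | `[< forall z, dom_set D z -> meromorphic_at f z >]].

Lemma meromorphic_on_subring : subring_closed meromorphic_on.
Proof.
split=> [|f g /asboolP hf /asboolP hg|f g /asboolP hf /asboolP hg]; apply/asboolP => z Dz.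
- exact: (meromorphic_cst 1).
- by apply: meromorphicB; [exact: hf|exact: hg].
- by apply: meromorphicM; [exact: hf|exact: hg].
Qed.

HB.instance Definition _ :=
  GRing.isSubringClosed.Build _ meromorphic_on meromorphic_on_subring.

(* Representatives are total functions on the plane: their values outside the
   domain and at isolated points of it are irrelevant, and [mero D] is the
   quotient identifying functions that agree on a punctured neighbourhood of
   every point of [D]. *)
Record premero := Premero {
  premero_val :> cplane R -> cplane R;
  premeroP : premero_val \in meromorphic_on }.

HB.instance Definition _ := [isSub for premero_val].
HB.instance Definition _ := [Choice of premero by <:].
HB.instance Definition _ := [SubChoice_isSubComNzRing of premero by <:].

Definition locally_null : {pred premero} :=
  [pred f : premero | `[< forall z, dom_set D z -> \forall w \near z^', f w = 0 >]].

Lemma locally_null_idealr : idealr_closed locally_null.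
Proof.
split=> [||h f g /asboolP hf /asboolP hg].
- by apply/asboolP => z _; near=> w.
- apply/asboolP => h1; have [z Dz] := dom_nonempty D.
  have [w /eqP] := filter_ex (h1 _ Dz).
  by rewrite (oner_eq0 (R[i])).
- apply/asboolP => z Dz; apply: filterS2 (hf _ Dz) (hg _ Dz) => w fw gw.
  have -> : (h * f + g) w = h w * f w + g w by [].
  by rewrite fw gw mulr0 addr0.
Unshelve. all: by end_near. Qed.

HB.instance Definition _ :=
  isIdealr.Build _ locally_null locally_null_idealr.

Definition mero := {ideal_quot locally_null}.
HB.instance Definition _ := GRing.ComNzRing.on mero.

(* [mero] is a field by the isolation of zeros and the connectedness of [D];
   since only its ring operations and invertibility are used here, it is given
   the structure of a commutative ring whose units are the elements having an
   inverse. *)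
Definition mero_unit : {pred mero} := [pred f | `[< exists g, g * f = 1 >]].
Definition mero_inv (f : mero) : mero :=
  if pselect (exists g, g * f = 1) is left ex then sval (cid ex) else f.

Lemma mero_mulVf : {in mero_unit, left_inverse 1 mero_inv *%R}.
Proof.
move=> f /asboolP ex; rewrite /mero_inv; case: pselect => // ex'.
exact: svalP (cid ex').
Qed.

Lemma mero_unitP (f g : mero) : g * f = 1 -> f \in mero_unit.
Proof. by move=> gf; apply/asboolP; exists g. Qed.

Lemma mero_inv_out : {in [predC mero_unit], mero_inv =1 id}.
Proof.
by move=> f /asboolP nex; rewrite /mero_inv; case: pselect.
Qed.

HB.instance Definition _ := GRing.ComNzRing_hasMulInverse.Build mero
  mero_mulVf mero_unitP mero_inv_out.

(* A singularity of a meromorphic function is at most a pole, so that the poles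
   are exactly the points at which it has no holomorphic extension. *)
Definition is_pole (f : mero) (z : cplane R) :=
  ~ removable_at (\val (repr f)) z.

(* The value of [f] at a point that is not a pole; a junk value at poles. *)
Definition mero_eval (f : mero) (z : cplane R) : R[i] :=
  lim (\val (repr f) @ z^').

Definition mx_eval (m n : nat) (Z : 'M[mero]_(m, n)) (z : cplane R) :
  'M[R[i]]_(m, n) := map_mx (mero_eval^~ z) Z.

Definition mx_pole (m n : nat) (Z : 'M[mero]_(m, n)) (z : cplane R) :=
  exists i j, is_pole (Z i j) z.

Definition pole_points (r n : nat) (f : mero) (M : 'M[mero]_r)
    (X Y : 'M[mero]_n) (a : {poly mero}) : set (cplane R) :=
  [set z | dom_set D z /\
    (is_pole f z \/ mx_pole M z \/ mx_pole X z \/ mx_pole Y z \/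
     exists k : nat, is_pole a`_k z)].

Definition latent_pair (DP : set (cplane R)) (r : nat) (Z : 'M[mero]_r)
    (lambda : cplane R) (u : 'cV[R[i]]_r) :=
  [/\ DP lambda, u != 0 & mx_eval Z lambda *m u = 0].

Definition is_root_in (DP : set (cplane R)) (g : mero) (lambda : cplane R) :=
  DP lambda /\ mero_eval g lambda = 0.

End MeromorphicField.

Definition p_mx (F : comNzRingType) (n : nat) (f : F) (Z : 'M[F]_n)
    (a : {poly F}) : 'M[F]_n :=
  \sum_(1 <= k < size a)
    a`_k *: \sum_(1 <= i < k.+1) f ^+ i.-1 *: (Z ^+ (k - i) : 'M[F]_n).

(* Main.v *)
Require Import Defs.
From HB Require Import structures.
From mathcomp Require Import all_boot all_order all_algebra.
From mathcomp Require Import complex.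
From mathcomp Require Import all_classical all_reals all_analysis.

Set Implicit Arguments.
Unset Strict Implicit.
Unset Printing Implicit Defensive.

Import GRing.Theory.

Local Open Scope classical_set_scope.
Local Open Scope quotient_scope.
Local Open Scope ring_scope.

(** Telescoping gives [(f I - Z) p(f, Z; a) = a(f) I - a(Z)].  For
    [Z = f I - X A Y] annihilated by [a] this reads [X A Y p = a(f) I], and
    cancelling [X] on the left yields [A P = a(f) I].  Hence
    [M * (- P B; a(f) I) = (0; S)].  The functions regular at a given point
    form a ring in which this identity already holds, and evaluation at the
    point is a ring morphism from it to the complex numbers: outside the poles,
    a vector killed by [S] is sent by [(- P B; a(f) I)] to one killed by [M]. *)

Section PMatrix.
Variable F : comNzRingType.

Lemma horner_mx_coef n (Z : 'M[F]_n.+1) (a : {poly F}) :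
  horner_mx Z a = \sum_(k < size a) a`_k *: Z ^+ k.
Proof.
rewrite -[in LHS](coefK a) poly_def raddf_sum; apply: eq_bigr => k _.
by rewrite /= linearZ /= rmorphXn /= horner_mx_X.
Qed.

Lemma p_mx_widen n N (f : F) (Z : 'M[F]_n) (a : {poly F}) : (size a <= N)%N ->
  p_mx f Z a = \sum_(k < N) a`_k *: \sum_(i < k) f ^+ i *: Z ^+ (k.-1 - i).
Proof.
move=> le_aN; pose term k := a`_k *: \sum_(i < k) f ^+ i *: Z ^+ (k.-1 - i).
have p_mx_term : p_mx f Z a = \sum_(1 <= k < size a) term k.
  apply: eq_bigr => k _; congr (_ *: _).
  rewrite big_add1 big_mkord; apply: eq_bigr => i _.
  by rewrite -predn_sub -subnS.
have add_term0 :
    \sum_(1 <= k < size a) term k = \sum_(0 <= k < size a) term k.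
  case: (size a) => [|d]; first by rewrite !big_geq.
  by rewrite [RHS]big_ltn// {2}/term big_ord0 scaler0 add0r.
have high_terms0 : \sum_(size a <= k < N) term k = 0.
  rewrite big_nat big1// => k /andP[le_ak _].
  by rewrite /term nth_default ?scale0r.
rewrite p_mx_term add_term0 -(big_mkord xpredT term).
by rewrite (big_cat_nat (leq0n _) le_aN) /= high_terms0 addr0.
Qed.

Lemma mul_subr_p_mx n (f : F) (Z : 'M[F]_n.+1) (a : {poly F}) :
  (f%:M - Z) *m p_mx f Z a = a.[f]%:M - horner_mx Z a.
Proof.
have comm_Zf : GRing.comm Z f%:M by exact: scalar_mxC.
rewrite (p_mx_widen _ _ (leqnn _)) mulmx_sumr horner_coef horner_mx_coef.
rewrite raddf_sum -sumrB; apply: eq_bigr => k _ /=.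
rewrite -scalemxAr -scalemx1 -scalerA -scalerBr scalemx1 rmorphXn /=.
rewrite -[_ - Z ^+ k]opprB (subrXX_comm _ comm_Zf) -mulNr opprB.
congr (_ *: (_ * _)); apply: eq_bigr => i _.
by rewrite -rmorphXn /= -mul_mx_scalar.
Qed.

End PMatrix.

Lemma map_p_mx (F K : comNzRingType) (phi : {rmorphism F -> K}) n (f : F)
    (Z : 'M[F]_n) (a : {poly F}) :
  map_mx phi (p_mx f Z a) = p_mx (phi f) (map_mx phi Z) (map_poly phi a).
Proof.
rewrite (p_mx_widen _ _ (leqnn _)) (p_mx_widen _ _ (size_poly _ _)) raddf_sum.
apply: eq_bigr => k _ /=; rewrite map_mxZ coef_map raddf_sum; congr (_ *: _).
by apply: eq_bigr => i _ /=; rewrite map_mxZ !rmorphXn.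
Qed.

(* The matrices P and S of the paper: when X is regular and [a] annihilates
   f I - X A Y, P is an adjugate of A relative to the scalar a(f), and S is the
   Schur complement of A in the block matrix, cleared of its denominator. *)
Section PSchur.
Variables (F : comNzRingType) (n s : nat).
Implicit Types (B : 'M[F]_(n, s)) (C : 'M[F]_(s, n)) (E : 'M[F]_s).
Implicit Types (f : F) (a : {poly F}).

Definition p_adj (A X Y : 'M[F]_n) f a : 'M[F]_n :=
  Y *m p_mx f (f%:M - X *m A *m Y) a *m X.

Definition p_schur (A : 'M[F]_n) B C E (X Y : 'M[F]_n) f a : 'M[F]_s :=
  a.[f] *: E - C *m p_adj A X Y f a *m B.

End PSchur.

Section MapPSchur.
Variables (F K : comNzRingType) (phi : {rmorphism F -> K}) (n s : nat).
Variables (A X Y : 'M[F]_n) (B : 'M[F]_(n, s)) (C : 'M[F]_(s, n)).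
Variables (E : 'M[F]_s) (f : F) (a : {poly F}).
Local Notation "Z ^phi" := (map_mx phi Z) (at level 1) : ring_scope.

Lemma map_p_adj :
  (p_adj A X Y f a)^phi = p_adj A^phi X^phi Y^phi (phi f) (map_poly phi a).
Proof. by rewrite !map_mxM map_p_mx map_mxB map_scalar_mx !map_mxM. Qed.

Lemma map_p_schur :
  (p_schur A B C E X Y f a)^phi =
  p_schur A^phi B^phi C^phi E^phi X^phi Y^phi (phi f) (map_poly phi a).
Proof. by rewrite map_mxB map_mxZ 2!map_mxM map_p_adj -horner_map. Qed.

End MapPSchur.

Section MulPAdj.
Variables (F : comNzRingType) (n s : nat).
Variables (A X Y : 'M[F]_n.+1) (f : F) (a : {poly F}).
Hypothesis X_lreg : GRing.lreg X.
Hypothesis a_annihilates : horner_mx (f%:M - X *m A *m Y) a = 0.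

Lemma mul_p_adj : A *m p_adj A X Y f a = a.[f]%:M.
Proof.
have := mul_subr_p_mx f (f%:M - X *m A *m Y) a.
rewrite a_annihilates subr0 subKr => XAYp; apply: X_lreg.
by rewrite -!mulmxE /p_adj !mulmxA XAYp scalar_mxC.
Qed.

Lemma mul_block_p_adj (B : 'M[F]_(n.+1, s)) (C : 'M[F]_(s, n.+1)) (E : 'M[F]_s) :
  block_mx A B C E *m col_mx (- (p_adj A X Y f a *m B)) a.[f]%:M =
  col_mx 0 (p_schur A B C E X Y f a).
Proof.
rewrite mul_block_col !mulmxN (mulmxA A) (mulmxA C) mul_p_adj.
by rewrite !mul_mx_scalar mul_scalar_mx addNr addrC.
Qed.

End MulPAdj.

Lemma inj_map_mx (T U : Type) (phi : T -> U) m n :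
  injective phi -> injective (@map_mx T U phi m n).
Proof.
move=> inj_phi Z W /matrixP eqZW; apply/matrixP => i j.
by have /[!mxE]/inj_phi := eqZW i j.
Qed.

Lemma inj_rmorph_lreg (F K : nzRingType) (phi : {rmorphism F -> K}) (x : F) :
  injective phi -> GRing.lreg (phi x) -> GRing.lreg x.
Proof.
move=> inj_phi reg_phix y z eq_xyz; apply/inj_phi/reg_phix.
by rewrite -!rmorphM eq_xyz.
Qed.

Lemma mx_sub_lift (T : Type) (P : pred T) (S : subType P) m n
    (Z : 'M[T]_(m, n)) :
  (forall i j, P (Z i j)) -> exists Z' : 'M[S]_(m, n), Z = map_mx val Z'.
Proof.
move=> PZ; exists (\matrix_(i, j) Sub (Z i j) (PZ i j)).
by apply/matrixP => i j; rewrite !mxE SubK.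
Qed.

Lemma poly_sub_lift (F : nzRingType) (P : pred F) (S : subNzRingType P)
    (a : {poly F}) :
  (forall k, P a`_k) -> exists a' : {poly S}, a = map_poly val a'.
Proof.
move=> Pa; exists (\poly_(k < size a) Sub a`_k (Pa k)).
apply/polyP => k; rewrite coef_map coef_poly.
case: ltnP => [_|le_ak]; first by rewrite /= SubK.
by rewrite raddf0 nth_default.
Qed.

Section HolomorphicExtension.
Variables (R : realType) (D : domain R).
Implicit Types (f : mero D) (g : cplane R -> cplane R) (z : cplane R).

Definition holomorphic_extension f z g :=
  holomorphic_at g z /\ \forall w \near z^', \val (repr f) w = g w.

Lemma near_repr_pi (u : premero D) z : dom_set D z ->
  \forall w \near z^', \val (repr (\pi_(mero D) u)) w = u w.
Proof.
move=> Dz.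
have /eqP : \pi_(mero D) (repr (\pi_(mero D) u)) = \pi_(mero D) u.
  by rewrite reprK.
rewrite -Quotient.idealrBE => /asboolP/(_ z Dz).
by apply: filterS => w /eqP; rewrite subr_eq0 => /eqP.
Qed.

Lemma mero_eval_extension f z g :
  holomorphic_extension f z g -> mero_eval f z = g z.
Proof.
move=> [hol_g fg].
have /derivable1_diffP/differentiable_continuous/continuous_withinNx g_cvg :=
  nbhs_singleton hol_g.
have f_cvg : \val (repr f) @ z^' --> g z.
  by apply: cvg_trans g_cvg; apply: near_eq_cvg; apply: filterS fg => w ->.
by apply: cvg_lim f_cvg; exact: norm_hausdorff.
Qed.

Lemma holomorphic_extension1 z :
  dom_set D z -> holomorphic_extension 1 z (fun=> 1).
Proof.
move=> Dz; split; first exact: holomorphic_cst.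
have -> : 1 = \pi_(mero D) 1 by rewrite rmorph1.
exact: near_repr_pi.
Qed.

Lemma holomorphic_extensionB f1 f2 z g1 g2 : dom_set D z ->
  holomorphic_extension f1 z g1 -> holomorphic_extension f2 z g2 ->
  holomorphic_extension (f1 - f2) z (fun w => g1 w - g2 w).
Proof.
move=> Dz [hol1 fg1] [hol2 fg2]; split; first exact: holomorphicB.
have -> : f1 - f2 = \pi_(mero D) (repr f1 - repr f2).
  by rewrite rmorphB /= !reprK.
have := near_repr_pi (repr f1 - repr f2) Dz.
by apply: filterS3 fg1 fg2 => w <- <- ->.
Qed.

Lemma holomorphic_extensionM f1 f2 z g1 g2 : dom_set D z ->
  holomorphic_extension f1 z g1 -> holomorphic_extension f2 z g2 ->
  holomorphic_extension (f1 * f2) z (fun w => g1 w * g2 w).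
Proof.
move=> Dz [hol1 fg1] [hol2 fg2]; split; first exact: holomorphicM.
have -> : f1 * f2 = \pi_(mero D) (repr f1 * repr f2).
  by rewrite rmorphM /= !reprK.
have := near_repr_pi (repr f1 * repr f2) Dz.
by apply: filterS3 fg1 fg2 => w <- <- ->.
Qed.

End HolomorphicExtension.

(* The point is bundled with its membership in the domain, without which the
   regular functions need not form a ring: the canonical structures below then
   need no side condition. *)
Section RegularFunctions.
Variables (R : realType) (D : domain R) (p : {z | dom_set D z}).
Let z := sval p.
Let Dz : dom_set D z := svalP p.

Definition regular_at : {pred mero D} := [pred f | `[< ~ is_pole f z >]].

Lemma regular_atP (f : mero D) :
  reflect (exists g, holomorphic_extension f z g) (f \in regular_at).
Proof.
apply: (iffP (asboolP _)) => [/contrapT[g hol_g fg]|[g [hol_g fg]]].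
  by exists g.
by apply; exists g.
Qed.

Lemma regular_at_subring : subring_closed regular_at.
Proof.
split=> [|f1 f2 /regular_atP[g1 fg1] /regular_atP[g2 fg2]
         |f1 f2 /regular_atP[g1 fg1] /regular_atP[g2 fg2]]; apply/regular_atP.
- by exists (fun=> 1); exact: holomorphic_extension1.
- by exists (fun w => g1 w - g2 w); exact: holomorphic_extensionB.
- by exists (fun w => g1 w * g2 w); exact: holomorphic_extensionM.
Qed.

HB.instance Definition _ :=
  GRing.isSubringClosed.Build _ regular_at regular_at_subring.

Record regular_fun := RegularFun {
  regular_fun_val :> mero D;
  regular_funP : regular_fun_val \in regular_at }.

HB.instance Definition _ := [isSub for regular_fun_val].
HB.instance Definition _ := [Choice of regular_fun by <:].
HB.instance Definition _ := [SubChoice_isSubComNzRing of regular_fun by <:].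

Definition regular_eval (f : regular_fun) : R[i] := mero_eval (val f) z.

Lemma regular_eval_is_zmod_morphism : zmod_morphism regular_eval.
Proof.
move=> f1 f2; rewrite /regular_eval.
have /regular_atP[g1 fg1] := regular_funP f1.
have /regular_atP[g2 fg2] := regular_funP f2.
rewrite (mero_eval_extension fg1) (mero_eval_extension fg2).
exact: mero_eval_extension (holomorphic_extensionB Dz fg1 fg2).
Qed.

Lemma regular_eval_is_monoid_morphism : monoid_morphism regular_eval.
Proof.
split=> [|f1 f2]; rewrite /regular_eval.
  exact: mero_eval_extension (holomorphic_extension1 Dz).
have /regular_atP[g1 fg1] := regular_funP f1.
have /regular_atP[g2 fg2] := regular_funP f2.
rewrite (mero_eval_extension fg1) (mero_eval_extension fg2).
exact: mero_eval_extension (holomorphic_extensionM Dz fg1 fg2).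
Qed.

HB.instance Definition _ := GRing.isZmodMorphism.Build
  regular_fun R[i] regular_eval regular_eval_is_zmod_morphism.
HB.instance Definition _ := GRing.isMonoidMorphism.Build
  regular_fun R[i] regular_eval regular_eval_is_monoid_morphism.

Lemma mx_eval_val m n (Z : 'M[regular_fun]_(m, n)) :
  mx_eval (map_mx val Z) z = map_mx regular_eval Z.
Proof. by rewrite /mx_eval -map_mx_comp. Qed.

Lemma not_mx_pole_lift m n (Z : 'M[mero D]_(m, n)) :
  ~ mx_pole Z z -> exists Z' : 'M[regular_fun]_(m, n), Z = map_mx val Z'.
Proof.
move=> nopole; apply: mx_sub_lift => i j; apply/asboolP => pole_Zij.
by apply: nopole; exists i, j.
Qed.

Lemma not_pole_points_lift r n (f : mero D) (M : 'M[mero D]_r)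
    (X Y : 'M[mero D]_n) (a : {poly mero D}) :
    ~ pole_points f M X Y a z ->
  exists (f' : regular_fun) (M' : 'M[regular_fun]_r)
    (X' Y' : 'M[regular_fun]_n) (a' : {poly regular_fun}),
  [/\ f = val f', M = map_mx val M', X = map_mx val X', Y = map_mx val Y' &
      a = map_poly val a'].
Proof.
move=> /not_andP[/(_ Dz)[]|].
move=> /not_orP[/asboolP f_reg].
move=> /not_orP[/not_mx_pole_lift[M' ->]].
move=> /not_orP[/not_mx_pole_lift[X' ->]].
move=> /not_orP[/not_mx_pole_lift[Y' ->] a_reg].
have [a' ->] : exists a' : {poly regular_fun}, a = map_poly val a'.
  apply: poly_sub_lift => k; apply/asboolP => pole_ak.
  by apply: a_reg; exists k.
by exists (RegularFun f_reg), M', X', Y', a'.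
Qed.

End RegularFunctions.

Lemma mx_eval_mul_block_p_adj (R : realType) (D : domain R) n s
    (A X Y : 'M[mero D]_n.+1) (B : 'M[mero D]_(n.+1, s))
    (C : 'M[mero D]_(s, n.+1)) (E : 'M[mero D]_s) (f : mero D)
    (a : {poly mero D}) (z : cplane R) :
    dom_set D z -> ~ pole_points f (block_mx A B C E) X Y a z ->
    X \in unitmx -> horner_mx (f%:M - X *m A *m Y) a = 0 ->
  mx_eval (block_mx A B C E) z *m
    col_mx (- (mx_eval (p_adj A X Y f a) z *m mx_eval B z))
           (mero_eval a.[f] z)%:M =
  col_mx 0 (mx_eval (p_schur A B C E X Y f a) z).
Proof.
move=> Dz nopole X_unit aZ; pose p : {z | dom_set D z} := exist _ z Dz.
have [f' [M [X' [Y' [a' [? + ? ? ?]]]]]] := not_pole_points_lift (p := p) nopole.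
rewrite -[M]submxK map_block_mx => /eq_block_mx[? ? ? ?]; subst.
have X'_lreg : GRing.lreg X'.
  apply: (inj_rmorph_lreg (phi := map_mx val)) (mulrI X_unit).
  exact: inj_map_mx val_inj.
have aZ' : horner_mx (f'%:M - X' *m ulsubmx M *m Y') a' = 0.
  apply: (inj_map_mx val_inj).
  by rewrite map_horner_mx map_mxB !map_mxM map_scalar_mx aZ map_mx0.
have eval_af : mero_eval (val a'.[f']) z = regular_eval (p := p) a'.[f'] by [].
rewrite -map_block_mx -map_p_adj -map_p_schur horner_map eval_af.
rewrite !(mx_eval_val (p := p)) -map_mxM -map_mxN -map_scalar_mx.
by rewrite -map_col_mx -map_mxM mul_block_p_adj// map_col_mx map_mx0.
Qed.

Theorem corollary3 (R : realType) (D : domain R) (n s : nat)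
    (calA : 'M[mero D]_n.+1) (calB : 'M[mero D]_(n.+1, s.+1))
    (calC : 'M[mero D]_(s.+1, n.+1)) (calD : 'M[mero D]_s.+1)
    (calX calY : 'M[mero D]_n.+1) (f : mero D) (a : {poly mero D}) :
  calX \in unitmx -> calY \in unitmx -> a != 0 ->
  horner_mx (f%:M - calX *m calA *m calY) a = 0 ->
  let calM := block_mx calA calB calC calD in
  let calP := calY *m p_mx f (f%:M - calX *m calA *m calY) a *m calX in
  let calS := a.[f] *: calD - calC *m calP *m calB in
  let DP := dom_set D `\` pole_points f calM calX calY a in
  forall (lambda0 : cplane R) (w0 : 'cV[R[i]]_s.+1),
  latent_pair DP calS lambda0 w0 ->
  ~ is_root_in DP a.[f] lambda0 ->
  latent_pair DP calM lambda0
    (col_mx (- (mx_eval calP lambda0 *m mx_eval calB lambda0))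
            ((mero_eval a.[f] lambda0)%:M) *m w0).
Proof.
move=> X_unit _ _ aZ calM calP calS DP z w [DPz w_neq0 Sw] not_root.
have [Dz nopole] := DPz.
have af_neq0 : mero_eval a.[f] z != 0 by apply/eqP => af0; apply: not_root.
split=> //.
- apply: contra_neq w_neq0; rewrite mul_col_mx mul_scalar_mx -[0]col_mx0.
  by move=> /eq_col_mx[_ /eqP]; rewrite scaler_eq0 (negbTE af_neq0) => /eqP.
- by rewrite mulmxA mx_eval_mul_block_p_adj// mul_col_mx mul0mx Sw col_mx0.
Qed.
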